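(* Let $A(y)\in\mathbb{R}^{m\times N_z}$ be a twice differentiable matrix-valued function of $y\in\mathbb{R}^{N_y}$ with full column rank for every $y$, let $b\in\mathbb{R}^m$, and consider the separable least squares objective $F(y,z)=\frac12\|A(y)z-b\|^2$. Then the Golub-Pereyra variable projection method is equivalent to the simplified semi-reduced method for $F$ using the Hessian model $H$ (defined in the context); that is, started from $y^0$ and $(y^0,z_m(y^0))$ respectively (with the same parameters $\delta,\alpha$), the two methods generate identical iterates.
   Context: Both methods use fixed parameters $\delta\in(0,1/2)$, $\alpha\in(0,1)$. For a full column rank matrix $X$, $X^{+}=(X^TX)^{-1}X^T$ and $P_X^\perp=I-XX^{+}$; $X_{:,j}$ is the $j$-th column of $X$. Dependence of $A$ on $y$ is suppressed. Here $z_m(y)=\mathrm{argmin}_zF(y,z)=A^{+}b$ and $F_r(y)=F(y,z_m(y))=\frac12\|-P_A^\perp b\|^2$. Subscripts $yy,yz,zy,zz$ denote blocks with respect to the splitting $x=(y,z)$. Hessian model $H$. Let $\mu(y,z)=A(y)z$ and let $J=[J_y,J_z]$ be its Jacobian: $(J_y)_{:,j}=(\partial_{y_j}A)z$, $J_z=A$. Write $\nabla^2F=G+E$, where $G=J^TJ$ and $E=\sum_i(\mu_i-b_i)\nabla^2\mu_i$ (so $E_{zz}=0$). Let $G_s=G_{yy}-G_{yz}G_{zz}^{-1}G_{zy}$ and $$U=\begin{bmatrix}I&(G_{yz}+E_{yz})G_{zz}^{-1}\\0&I\end{bmatrix},\qquad \hat H=\begin{bmatrix}G_s+E_{yz}G_{zz}^{-1}E_{zy}&0\\0&G_{zz}\end{bmatrix},\qquad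 H=U\hat HU^T.$$ ($U$ is the unit block upper triangular factor of the block $UDU^T$ factorization of $\nabla^2F$, and $\hat H$ is the block diagonal part of $U^{-1}GU^{-T}$.) It is assumed (standing assumption on Hessian models) that $H$ is positive definite at every point $(y,z_m(y))$. Golub-Pereyra variable projection method. The backtracking line search method on $F_r$ with Hessian model $\mathscr{B}_r(y)=K_r^TK_r$, where $K_r$ is the Jacobian of the reduced residual $-P_A^\perp b$, with columns $$(K_r)_{:,j}=-\left(P_A^\perp(\partial_{y_j}A)A^{+}+\left(P_A^\perp(\partial_{y_j}A)A^{+}\right)^T\right)b:$$ for $k=0,1,2,\dots$, set $g=\nabla F_r(y^k)$, $B_r=\mathscr{B}_r(y^k)$; solve $B_r\Delta y=-g$; let $y_p(s)=y^k+s\Delta y$; find the smallest integer $j\ge0$ with $F_r(y_p(\alpha^j))-F_r(y^k)\le\delta g^T(y_p(\alpha^j)-y^k)$; set $y^{k+1}=y_p(\alpha^j)$. Simplified semi-reduced method (with Hessian model $\mathscr{B}_f=H$). Start at $x^0=(y^0,z_m(y^0))$. For $k=0,1,2,\dots$: with $x^k=(y^k,z^k)$, set $g_y=\nabla_yF(x^k)$ and $B=\mathscr{B}_f(x^k)$, and $B_s=B_{yy}-B_{yz}B_{zz}^{-1}B_{zy}$; solve $B_s\Delta y=-g_y$; let $x_p(s)=(y_p(s),z_p(s))=(y^k+s\Delta y,\ z_m(y^k+s\Delta y))$; find the smallest integer $j\ge0$ with $F(x_p(\alpha^j))-F(x^k)\le\delta g_y^T(y_p(\alpha^j)-y^k)$;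 set $x^{k+1}=x_p(\alpha^j)$. ''Identical iterates'' means that the vectors $y^k$ produced by the two methods coincide for all $k$ (and $z^k=z_m(y^k)$ in the second method). *)

(* Defs.v *)
From HB Require Import structures.
From mathcomp Require Import all_boot all_order all_algebra.
From mathcomp Require Import all_classical all_reals all_analysis.
Set Implicit Arguments.
Unset Strict Implicit.
Unset Printing Implicit Defensive.
Import Order.TTheory GRing.Theory Num.Theory.
Import numFieldNormedType.Exports.
Local Open Scope ring_scope.

Section LinearAlgebra.
Context {R : realType}.

(* The norm `|v| of MathComp-Analysis on matrices is the max norm; this is the
   squared Euclidean norm. *)
Definition sqnorm n (v : 'cV[R]_n) : R := (v^T *m v) 0 0.

(* Not the library's pinvmx, which is some partial inverse depending on
   Gaussian elimination. *)
Definition lpinv m n (X : 'M[R]_(m, n)) : 'M[R]_(n, m) :=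
  invmx (X^T *m X) *m X^T.

Definition projperp m n (X : 'M[R]_(m, n)) : 'M[R]_m := 1%:M - X *m lpinv X.

Definition schur p q (B : 'M[R]_(p + q)) : 'M[R]_p :=
  ulsubmx B - ursubmx B *m invmx (drsubmx B) *m dlsubmx B.

(* Symmetry is not part of the definition. *)
Definition posdefmx n (B : 'M[R]_n) : Prop :=
  forall v : 'cV[R]_n, v != 0 -> 0 < (v^T *m B *m v) 0 0.

End LinearAlgebra.

Section Calculus.
Context {R : realType}.

Definition pderive n (V : normedModType R) (j : 'I_n) (f : 'cV[R]_n -> V)
    (x : 'cV[R]_n) : V :=
  'D_(delta_mx j 0) f x.

Definition gradient n (f : 'cV[R]_n -> R) (x : 'cV[R]_n) : 'cV[R]_n :=
  \col_j pderive j f x.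

(* Column j is the j-th partial derivative. The library's 'J f x acts on row
   vectors and is the transpose of this matrix. *)
Definition jacobian_mx n m (f : 'cV[R]_n -> 'cV[R]_m) (x : 'cV[R]_n) :
    'M[R]_(m, n) :=
  \matrix_(i, j) pderive j f x i 0.

Definition hessian n (f : 'cV[R]_n -> R) (x : 'cV[R]_n) : 'M[R]_n :=
  \matrix_(i, j) pderive i (pderive j f) x.

(* The domain is finite dimensional, so the differential x |-> 'd f x is
   differentiable iff x |-> 'd f x v = 'D_v f x is, for every v. *)
Definition twice_differentiable n (V : normedModType R) (f : 'cV[R]_n -> V) :
    Prop :=
  (forall x, differentiable f x) /\
  (forall v x, differentiable (fun u => 'D_v f u) x).

End Calculus.

Section SeparableLeastSquares.
Context {R : realType} {m Ny Nz : nat}.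
Variables (A : 'cV[R]_Ny -> 'M[R]_(m, Nz)) (b : 'cV[R]_m).

(* Points x = (y, z) are the stacked vectors col_mx y z. *)
Implicit Types (x : 'cV[R]_(Ny + Nz)) (y : 'cV[R]_Ny) (z : 'cV[R]_Nz).

Definition mu x : 'cV[R]_m := A (usubmx x) *m dsubmx x.

Definition Fobj x : R := 2^-1 * sqnorm (mu x - b).

(* The unique minimizer of z |-> F(y, z): see zmin_argmin. *)
Definition zmin y : 'cV[R]_Nz := lpinv (A y) *m b.

Definition ylift y : 'cV[R]_(Ny + Nz) := col_mx y (zmin y).

Definition Fred y : R := Fobj (ylift y).

Definition resred y : 'cV[R]_m := - (projperp (A y) *m b).

(* Computed explicitly in KredE. *)
Definition Kred y : 'M[R]_(m, Ny) := jacobian_mx resred y.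

Definition Bred y : 'M[R]_Ny := (Kred y)^T *m Kred y.

Definition Gmx x : 'M[R]_(Ny + Nz) :=
  (jacobian_mx mu x)^T *m jacobian_mx mu x.

Definition Emx x : 'M[R]_(Ny + Nz) :=
  \sum_i (mu x i 0 - b i 0) *: hessian (fun u => mu u i 0) x.

Definition Umx x : 'M[R]_(Ny + Nz) :=
  block_mx 1%:M
    ((ursubmx (Gmx x) + ursubmx (Emx x)) *m invmx (drsubmx (Gmx x)))
    0 1%:M.

Definition Hhat x : 'M[R]_(Ny + Nz) :=
  block_mx
    (schur (Gmx x) +
     ursubmx (Emx x) *m invmx (drsubmx (Gmx x)) *m dlsubmx (Emx x)) 0
    0 (drsubmx (Gmx x)).

Definition Hmodel x : 'M[R]_(Ny + Nz) := Umx x *m Hhat x *m (Umx x)^T.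

End SeparableLeastSquares.

Section Methods.
Context {R : realType}.
Variables (delta alpha : R).

Definition least (P : nat -> Prop) (j : nat) : Prop :=
  P j /\ forall i, P i -> (j <= i)%N.

Definition line_search_step n (f : 'cV[R]_n -> R) (B : 'cV[R]_n -> 'M[R]_n)
    (y y' : 'cV[R]_n) : Prop :=
  exists (dy : 'cV[R]_n) (j : nat),
    let g := gradient f y in
    let yp s := y + s *: dy in
    [/\ B y *m dy = - g,
        least (fun i => f (yp (alpha ^+ i)) - f y
                        <= delta * (g^T *m (yp (alpha ^+ i) - y)) 0 0) j
      & y' = yp (alpha ^+ j)].

Definition line_search_method n (f : 'cV[R]_n -> R)
    (B : 'cV[R]_n -> 'M[R]_n) (y0 : 'cV[R]_n) (y : nat -> 'cV[R]_n) : Prop :=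
  y 0%N = y0 /\ forall k, line_search_step f B (y k) (y k.+1).

Definition semi_reduced_step p q (F : 'cV[R]_(p + q) -> R)
    (zm : 'cV[R]_p -> 'cV[R]_q) (Bf : 'cV[R]_(p + q) -> 'M[R]_(p + q))
    (x x' : 'cV[R]_(p + q)) : Prop :=
  exists (dy : 'cV[R]_p) (j : nat),
    let y := usubmx x in
    let gy := usubmx (gradient F x) in
    let yp s := y + s *: dy in
    let xp s := col_mx (yp s) (zm (yp s)) in
    [/\ schur (Bf x) *m dy = - gy,
        least (fun i => F (xp (alpha ^+ i)) - F x
                        <= delta * (gy^T *m (yp (alpha ^+ i) - y)) 0 0) j
      & x' = xp (alpha ^+ j)].

Definition semi_reduced_method p q (F : 'cV[R]_(p + q) -> R)
    (zm : 'cV[R]_p -> 'cV[R]_q) (Bf : 'cV[R]_(p + q) -> 'M[R]_(p + q))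
    (y0 : 'cV[R]_p) (x : nat -> 'cV[R]_(p + q)) : Prop :=
  x 0%N = col_mx y0 (zm y0) /\
  forall k, semi_reduced_step F zm Bf (x k) (x k.+1).

End Methods.

Definition golub_pereyra_method (R : realType) (m Ny Nz : nat)
    (delta alpha : R) (A : 'cV[R]_Ny -> 'M[R]_(m, Nz)) (b : 'cV[R]_m) :=
  line_search_method delta alpha (Fred A b) (Bred A b).

Definition semi_reduced_H_method (R : realType) (m Ny Nz : nat)
    (delta alpha : R) (A : 'cV[R]_Ny -> 'M[R]_(m, Nz)) (b : 'cV[R]_m) :=
  semi_reduced_method delta alpha (Fobj A b) (zmin A b) (Hmodel A b).

Section LinearAlgebraFacts.
Context {R : realType}.

Lemma sqnormE n (v : 'cV[R]_n) : sqnorm v = \sum_i v i 0 ^+ 2.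
Proof. by rewrite /sqnorm !mxE; apply: eq_bigr => i _; rewrite mxE expr2. Qed.

Lemma sqnorm_ge0 n (v : 'cV[R]_n) : 0 <= sqnorm v.
Proof. by rewrite sqnormE sumr_ge0 // => i _; exact: sqr_ge0. Qed.

Lemma sqnorm_eq0 n (v : 'cV[R]_n) : sqnorm v = 0 -> v = 0.
Proof.
rewrite sqnormE => /eqP; rewrite psumr_eq0 => [/allP v0|i _]; last exact: sqr_ge0.
apply/colP => i; rewrite mxE; apply/eqP.
by have /= := v0 i (mem_index_enum i); rewrite expf_eq0.
Qed.

Lemma gram_unit m n (X : 'M[R]_(m, n)) : \rank X = n -> X^T *m X \in unitmx.
Proof.
move=> rkX; rewrite -row_free_unit -kermx_eq0.
apply/eqP/row_matrixP => i; rewrite row0; set v := row i _.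
have v0 : v *m (X^T *m X) = 0 by apply/sub_kermxP; exact: row_sub.
have w0 : (v *m X^T)^T = 0.
  apply: sqnorm_eq0; rewrite /sqnorm trmxK trmx_mul trmxK mulmxA -[_ *m X]mulmxA.
  by rewrite v0 mul0mx mxE.
have /row_free_inj inj : row_free X^T by rewrite /row_free mxrank_tr rkX.
by apply: (inj _); rewrite mul0mx -[LHS]trmxK w0 trmx0.
Qed.

Lemma lpinvK m n (X : 'M[R]_(m, n)) : \rank X = n -> lpinv X *m X = 1%:M.
Proof. by move=> /gram_unit Xu; rewrite /lpinv -mulmxA mulVmx. Qed.

Lemma mul_lpinv_tr m n (X : 'M[R]_(m, n)) : (X *m lpinv X)^T = X *m lpinv X.
Proof.
by rewrite /lpinv !trmx_mul trmxK trmx_inv trmx_mul trmxK mulmxA.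
Qed.

Lemma tr_projperp m n (X : 'M[R]_(m, n)) : (projperp X)^T = projperp X.
Proof. by rewrite /projperp linearB /= mul_lpinv_tr trmx1. Qed.

Lemma projperp_mul m n (X : 'M[R]_(m, n)) :
  \rank X = n -> projperp X *m X = 0.
Proof.
by move=> rkX; rewrite /projperp mulmxBl mul1mx -mulmxA lpinvK // mulmx1 subrr.
Qed.

End LinearAlgebraFacts.

Section MatrixDerivatives.
Context {R : realType} {V : normedModType R}.

Lemma is_derive_mxP m n (M : V -> 'M[R]_(m, n)) (dM : 'M[R]_(m, n)) t v :
  is_derive t v M dM <->
  forall i j, is_derive t v (fun x => M x i j) (dM i j).
Proof.
split=> [[Md <-] i j|Md].
  rewrite derive_mx // mxE; apply: DeriveDef => //.
  by move/derivable_mxP: Md; apply.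
have Mv : derivable M t v by apply/derivable_mxP => i j; case: (Md i j).
apply: DeriveDef => //; rewrite derive_mx //; apply/matrixP => i j.
by rewrite mxE; case: (Md i j).
Qed.

Lemma is_derive_mulmx m n p (M : V -> 'M[R]_(m, n)) (N : V -> 'M[R]_(n, p))
    dM dN t v : is_derive t v M dM -> is_derive t v N dN ->
  is_derive t v (fun x => M x *m N x) (dM *m N t + M t *m dN).
Proof.
move=> /is_derive_mxP Md /is_derive_mxP Nd; apply/is_derive_mxP => i j.
have -> : (fun x => (M x *m N x) i j) =
    \sum_k ((fun x => M x i k) * (fun x => N x k j)).
  by apply/funext => x; rewrite mxE fct_sumE.
apply: is_derive_eq.
rewrite !mxE -big_split /=; apply: eq_bigr => k _.
by rewrite addrC /GRing.scale /= [_ * dM _ _]mulrC.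
Qed.

Lemma is_derive_trmx m n (M : V -> 'M[R]_(m, n)) dM t v :
  is_derive t v M dM -> is_derive t v (fun x => (M x)^T) dM^T.
Proof.
move=> /is_derive_mxP Md; apply/is_derive_mxP => i j; rewrite mxE.
by under eq_fun do rewrite mxE; exact: Md.
Qed.

Lemma derivable_det n (M : V -> 'M[R]_n) t v :
  derivable M t v -> derivable (fun x => \det (M x)) t v.
Proof.
move=> /derivable_mxP Md.
have derivable_prod (I : Type) (r : seq I) (f : I -> V -> R) :
    (forall i, derivable (f i) t v) ->
    derivable (fun x => \prod_(i <- r) f i x) t v.
  move=> fd; elim: r => [|i r IHr].
    by under eq_fun do rewrite big_nil; exact: derivable_cst.
  by under eq_fun do rewrite big_cons; exact: (derivableM (fd i) IHr).
rewrite /determinant; elim: (index_enum _) => [|s r IHr].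
  by under eq_fun do rewrite big_nil; exact: derivable_cst.
under eq_fun do rewrite big_cons.
apply: (derivableD _ IHr); apply: derivableM; first exact: derivable_cst.
by apply: derivable_prod => i; exact: Md.
Qed.

Lemma derivable_invmx n (M : V -> 'M[R]_n) t v :
  (forall x, M x \in unitmx) -> derivable M t v ->
  derivable (fun x => invmx (M x)) t v.
Proof.
move=> Mu Md; apply/derivable_mxP => i j.
have -> : (fun x => invmx (M x) i j) =
    ((fun x => (\det (M x))^-1) * (fun x => cofactor (M x) j i)).
  by apply/funext => x; rewrite /invmx Mu !mxE.
apply: derivableM.
  apply: derivableV; last exact: derivable_det.
  by rewrite -unitfE -unitmxE.
rewrite /cofactor; apply: derivableM; first exact: derivable_cst.
apply: derivable_det; apply/derivable_mxP => k l.
under eq_fun do rewrite !mxE.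
by move/derivable_mxP: Md; apply.
Qed.

End MatrixDerivatives.

Lemma is_derive_lin (R : realType) (U V W : normedModType R)
    (L : {linear U -> V}) (f : V -> W) (x v : U) (df : W) :
  is_derive (L x) (L v) f df -> is_derive x v (f \o L) df.
Proof.
have E : (fun h : R => h^-1 *: (((f \o L) \o shift x) (h *: v) - (f \o L) x)) =
    (fun h : R => h^-1 *: ((f \o shift (L x)) (h *: L v) - f (L x))).
  by apply/funext => h /=; rewrite [L (_ + _)]linearD [L (_ *: _)]linearZZ.
by case=> fd <-; apply: DeriveDef; rewrite /derivable /derive E.
Qed.

Section SeparableLeastSquaresFacts.
Context {R : realType} {m Ny Nz : nat}.
Variables (A : 'cV[R]_Ny -> 'M[R]_(m, Nz)) (b : 'cV[R]_m).
Hypothesis rkA : forall y, \rank (A y) = Nz.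

Lemma residual_zmin y : mu A (col_mx y (zmin A b y)) - b = resred A b y.
Proof.
rewrite /mu col_mxKu col_mxKd /resred /projperp /zmin mulmxBl mul1mx opprB.
by rewrite mulmxA.
Qed.

Lemma FredE y : Fred A b y = 2^-1 * sqnorm (resred A b y).
Proof. by rewrite /Fred /Fobj /ylift residual_zmin. Qed.

Lemma zmin_argmin y z : z != zmin A b y ->
  Fobj A b (col_mx y (zmin A b y)) < Fobj A b (col_mx y z).
Proof.
move=> zNzm; rewrite /Fobj residual_zmin ltr_pM2l ?invr_gt0 ?ltr0n //.
set r := resred A b y; set d := A y *m (z - zmin A b y).
have -> : mu A (col_mx y z) - b = d + r.
  rewrite /r -residual_zmin /mu !col_mxKu !col_mxKd /d mulmxBr addrA.
  by rewrite subrK.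
have dr : d^T *m r = 0.
  rewrite /d /r /resred trmx_mul mulmxN -mulmxA [_^T *m (_ *m b)]mulmxA.
  by rewrite -[projperp _]tr_projperp -trmx_mul projperp_mul // trmx0 mul0mx
             mulmx0 oppr0.
have -> : sqnorm (d + r) = sqnorm d + sqnorm r.
  have rd : r^T *m d = 0 by rewrite -[LHS]trmxK trmx_mul trmxK dr trmx0.
  rewrite /sqnorm [(d + r)^T]linearD /= mulmxDl !mulmxDr dr rd addr0 add0r.
  by rewrite mxE.
rewrite ltrDr lt_neqAle sqnorm_ge0 andbT eq_sym; apply/eqP => /sqnorm_eq0 d0.
move/eqP: zNzm; apply; apply/eqP; rewrite -subr_eq0; apply/eqP.
by rewrite -[LHS]mul1mx -(lpinvK (rkA y)) -mulmxA -/d d0 mulmx0.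
Qed.

Hypothesis dA : forall y, differentiable A y.

Let dAv y v : is_derive y v A ('D_v A y).
Proof. by apply: DeriveDef => //; exact: diff_derivable. Qed.

(* J = [J_y, J_z]. *)
Lemma jacobian_muE y z : jacobian_mx (mu A) (col_mx y z) =
  row_mx (\matrix_(i, j) (pderive j A y *m z) i 0) (A y).
Proof.
have Dmu v : 'D_v (mu A) (col_mx y z) =
    'D_(usubmx v) A y *m z + A y *m dsubmx v.
  have dU : is_derive (col_mx y z) v (fun x => A (usubmx x))
      ('D_(usubmx v) A y).
    by apply: (@is_derive_lin R _ _ _ usubmx); rewrite /= col_mxKu.
  have dD : is_derive (col_mx y z) v (fun x => dsubmx x) (dsubmx v).
    by apply: (@is_derive_lin R _ _ _ dsubmx id); exact: is_derive_id.
  have [_ ->] := is_derive_mulmx dU dD.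
  by rewrite col_mxKu col_mxKd.
apply/matrixP => i j; rewrite mxE /pderive Dmu.
case: (split_ordP j) => k ->.
  rewrite row_mxEl [RHS]mxE [LHS]mxE.
  have -> : delta_mx (lshift Nz k) 0 = col_mx (delta_mx k 0) 0 :> 'cV[R]_(Ny + Nz).
    apply/colP => l; rewrite !mxE; case: (split_ordP l) => l' ->;
    by rewrite !mxE ?eq_lshift ?eq_rlshift ?eq_lrshift.
  by rewrite col_mxKu col_mxKd mulmx0 [X in _ + X]mxE addr0.
rewrite row_mxEr [LHS]mxE.
have -> : delta_mx (rshift Ny k) 0 = col_mx 0 (delta_mx k 0) :> 'cV[R]_(Ny + Nz).
  apply/colP => l; rewrite !mxE; case: (split_ordP l) => l' ->;
  by rewrite !mxE ?eq_rshift ?eq_rlshift ?eq_lrshift.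
by rewrite col_mxKu col_mxKd derive0 mul0mx [X in X + _]mxE add0r -colE mxE.
Qed.

(* The explicit columns
     - (P_A^perp (d_j A) A^+ + (P_A^perp (d_j A) A^+)^T) b,
   as usually displayed, are those of the Jacobian of P_A^perp b, that is,
   minus those of Kred; Bred does not depend on this sign. *)
Definition golub_pereyra_mx y : 'M[R]_(m, Ny) :=
  \matrix_(i, j)
    (let M := projperp (A y) *m pderive j A y *m lpinv (A y) in
     (- ((M + M^T) *m b)) i 0).

Lemma KredE y : Kred A b y = - golub_pereyra_mx y.
Proof.
apply/matrixP => i j; rewrite mxE [RHS]mxE [X in - X]mxE [X in - X]mxE opprK.
congr (_ i 0); rewrite /pderive.
set v := delta_mx j 0; set D := 'D_v A y; set X := lpinv (A y).
have dAT := is_derive_trmx (dAv y v).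
have dG := is_derive_mulmx dAT (dAv y v).
set P := fun u => A u *m lpinv (A u).
have [dP PE] : exists dP, is_derive y v P dP.
  have Gi : derivable (fun u => invmx ((A u)^T *m A u)) y v.
    by apply: derivable_invmx => [u|]; [exact: gram_unit|case: dG].
  have := is_derive_mulmx (dAv y v) (is_derive_mulmx (derivableP Gi) dAT).
  by move=> ?; eexists; eassumption.
have PA : dP *m A y + P y *m D = D.
  have [_ <-] := is_derive_mulmx PE (dAv y v).
  have -> : (fun u => P u *m A u) = A.
    by apply/funext => u; rewrite /P -mulmxA lpinvK ?mulmx1.
  by [].
have PT : dP^T = dP.
  have [_ <-] := is_derive_trmx PE.
  have -> : (fun u => (P u)^T) = P by apply/funext => u; rewrite mul_lpinv_tr.
  by case: PE.
have PP : dP *m P y + P y *m dP = dP.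
  have [_ <-] := is_derive_mulmx PE PE.
  have -> : (fun u => P u *m P u) = P.
    by apply/funext => u; rewrite /P -mulmxA [lpinv _ *m _]mulmxA lpinvK ?mul1mx.
  by case: PE.
have PX : dP *m P y = projperp (A y) *m D *m X.
  rewrite /P mulmxA; congr (_ *m _).
  by apply/eqP; rewrite /projperp mulmxBl mul1mx eq_sym subr_eq PA.
have Presred : resred A b = (fun u => P u *m b - b).
  by apply/funext => u; rewrite /resred /projperp mulmxBl mul1mx opprB.
have -> : 'D_v (resred A b) y = dP *m b.
  have Pb : is_derive y v (fun u => P u *m b) (dP *m b).
    apply: is_derive_eq; first exact: (is_derive_mulmx PE (is_derive_cst b y v)).
    by rewrite mulmx0 addr0.
  rewrite Presred.
  have -> : (fun u => P u *m b - b) = (fun u => P u *m b) - cst b by [].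
  by rewrite deriveB ?derive_cst ?subr0; case: Pb.
congr (_ *m b); rewrite -PX trmx_mul PT /P mul_lpinv_tr.
by rewrite -[LHS]PP.
Qed.

Lemma BredE y : Bred A b y = (golub_pereyra_mx y)^T *m golub_pereyra_mx y.
Proof. by rewrite /Bred KredE [(- _)^T]linearN /= mulNmx mulmxN opprK. Qed.

End SeparableLeastSquaresFacts.

(* Main.v *)
Require Import Defs.
From mathcomp Require Import all_boot all_order all_algebra.
From mathcomp Require Import all_classical all_reals all_analysis.
Set Implicit Arguments.
Unset Strict Implicit.
Unset Printing Implicit Defensive.
Import Order.TTheory GRing.Theory Num.Theory.
Import numFieldNormedType.Exports.
Local Open Scope classical_set_scope.
Local Open Scope ring_scope.

(** Write P for the orthogonal projector onto the complement of the range of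
    A(y), A^+ for the left pseudo-inverse of A(y), and r = A(y) z_m(y) - b
    = - P b for the residual on the curve z = z_m(y). Everything rests on
    A(y)^T r = 0, the optimality of z_m(y).

    The gradients agree: by the chain rule D_v F_r = r^T (D_v A) z_m
    + r^T A (D_v z_m), and the last term vanishes, so that only the partial
    derivative of F in y survives ([is_derive_Fred], [usubmx_gradient_Fobj]).

    The matrices agree: since H is given in block U D U^T form, its Schur
    complement is the upper left block of the middle factor ([schur_udu]),
    that is, J_y^T P J_y + E_yz (A^T A)^{-1} E_zy. On the other side, the
    Jacobian of the reduced residual is K_r = P J_y - (A^+)^T E_zy
    ([Kred_split]), because E_zy has columns (d_j A)^T r. Its two terms have
    orthogonal ranges and A^+ (A^+)^T = (A^T A)^{-1}, so K_r^T K_r is the same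
    matrix ([schur_Hmodel]).

    Hence a semi-reduced step is the lift of a line search step on F_r
    ([semi_reduced_methodE]). It remains to see that the iteration is well
    defined. Positive definiteness of H passes by congruence to the middle
    factor, hence to its upper left block, which is B_r; so the linear system
    has exactly one solution, which is zero or a descent direction, and
    backtracking stops since
    D_v F_r = g^T v for all v ([line_search_method_exists_unique]). *)

(** * Positive definite matrices and Schur complements *)

Section PositiveDefinite.
Context {R : realType}.

Lemma posdefmx_unit n (B : 'M[R]_n) : posdefmx B -> B \in unitmx.
Proof.
move=> Bpd; rewrite -unitmx_tr -row_free_unit -kermx_eq0.
apply/eqP/row_matrixP => i; rewrite row0; set u := row i _.
have Bu0 : B *m u^T = 0.
  have uB0 : u *m B^T = 0 by apply/sub_kermxP; exact: row_sub.
  by rewrite -[LHS]trmxK trmx_mul trmxK uB0 trmx0.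
apply/eqP/contraT => u0.
have := Bpd u^T; rewrite -mulmxA Bu0 mulmx0 mxE ltxx trmx_eq0.
by move/(_ u0).
Qed.

Lemma posdefmx_congr n (U B : 'M[R]_n) :
  U \in unitmx -> posdefmx (U *m B *m U^T) -> posdefmx B.
Proof.
move=> Uu Bpd v v0; set w := invmx U^T *m v.
have vE : U^T *m w = v by rewrite mulKVmx ?unitmx_tr.
have w0 : w != 0 by apply: contra_neq v0 => w0; rewrite -vE w0 mulmx0.
clearbody w; have := Bpd _ w0; rewrite -vE trmx_mul trmxK !mulmxA; exact.
Qed.

Lemma posdefmx_ulsub p q (B : 'M[R]_(p + q)) :
  posdefmx B -> posdefmx (ulsubmx B).
Proof.
move=> Bpd v v0.
have w0 : col_mx v 0 != 0 :> 'cV[R]_(p + q).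
  by apply: contra_neq v0 => /(congr1 usubmx); rewrite col_mxKu linear0.
have := Bpd _ w0; rewrite -{1}[B]submxK -mulmxA mul_block_col tr_col_mx.
by rewrite mul_row_col !mulmx0 trmx0 mul0mx !addr0 mulmxA.
Qed.

(** The Schur complement is the elimination that produces the block U D U^T
    factorization, so it does not see the off-diagonal block of U. *)
Lemma schur_udu p q (W : 'M[R]_(p, q)) (S : 'M[R]_p) (D : 'M[R]_q) :
  D \in unitmx ->
  let U := block_mx 1%:M W 0 1%:M in
  schur (U *m block_mx S 0 0 D *m U^T) = S.
Proof.
move=> Du /=; rewrite tr_block_mx !trmx1 trmx0 !mulmx_block /schur.
rewrite block_mxKul block_mxKur block_mxKdr block_mxKdl.
rewrite !(mul1mx, mulmx1, mul0mx, mulmx0, add0r, addr0).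
by rewrite mulmxK // mulmxA addrK.
Qed.

End PositiveDefinite.

(** * Backtracking line search *)

Section LineSearch.
Context {R : realType}.
Variables (delta alpha : R).
Hypotheses (delta_bounds : 0 < delta < 1 / 2) (alpha_bounds : 0 < alpha < 1).

(** The difference quotients at steps alpha ^+ i tend to df, which is strictly
    below delta * df because df < 0 and delta < 1. *)
Lemma armijo_backtracking (V : normedModType R) (f : V -> R) x v df :
  is_derive x v f df -> df < 0 ->
  exists i, f (x + alpha ^+ i *: v) - f x <= delta * (alpha ^+ i * df).
Proof.
move=> [fd fdE] df0; case/andP: alpha_bounds => alpha0 alpha1.
have df_lt : df < delta * df.
  rewrite ltr_nMl //; case/andP: delta_bounds => _ /lt_trans; apply.
  by rewrite ltr_pdivrMr ?mul1r ?ltr1n.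
have near0 : \forall h \near (0 : R)^',
    h^-1 *: (f (h *: v + x) - f x) < delta * df.
  apply: cvgr_lt df_lt; rewrite -fdE; exact: fd.
have alpha_cvg : alpha ^+ i @[i --> \oo] --> (0 : R).
  by apply: cvg_expr; rewrite ger0_norm ?ltW.
move: near0; rewrite near_withinE => /alpha_cvg[N _ /(_ N (leqnn N))] /=.
have aN0 : 0 < alpha ^+ N by rewrite exprn_gt0.
rewrite lt0r_neq0 // => /(_ isT) /ltW aN; exists N.
by rewrite mulrCA -ler_pdivrMl // [x + _]addrC.
Qed.

Lemma least_inj (P : nat -> Prop) i j : least P i -> least P j -> i = j.
Proof. by move=> [Pi Li] [Pj Lj]; apply/eqP; rewrite eqn_leq Li ?Lj. Qed.

Lemma least_exists (P : nat -> Prop) : (exists i, P i) -> exists j, least P j.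
Proof.
move=> [i Pi]; have exP : exists i, `[< P i >] by exists i; apply/asboolP.
case: (ex_minnP exP) => j /asboolP Pj Lj; exists j; split=> // k Pk.
by apply: Lj; apply/asboolP.
Qed.

Variables (n : nat) (f : 'cV[R]_n -> R) (B : 'cV[R]_n -> 'M[R]_n).
Hypothesis Bpd : forall y, posdefmx (B y).

Lemma line_search_step_inj y y1 y2 :
  line_search_step delta alpha f B y y1 ->
  line_search_step delta alpha f B y y2 -> y1 = y2.
Proof.
move=> [d1 [j1 [E1 L1 ->]]] [d2 [j2 [E2 L2 ->]]].
have dE : d1 = d2.
  by rewrite -[d1](mulKmx (posdefmx_unit (Bpd y))) E1 -E2 mulKmx ?posdefmx_unit.
by rewrite -dE in L2 *; rewrite (least_inj L1 L2).
Qed.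

(** A form of differentiability that only asks for what the line search uses:
    the gradient computes the derivative along every direction. *)
Hypothesis f_diff :
  forall y v, is_derive y v f (((gradient f y)^T *m v) 0 0).

Lemma line_search_step_exists y :
  exists y', line_search_step delta alpha f B y y'.
Proof.
set g := gradient f y; pose d := - (invmx (B y) *m g).
have Bd : B y *m d = - g by rewrite mulmxN mulKVmx ?posdefmx_unit.
clearbody d.
(* Either y is stationary and j = 0 is accepted, or d is a descent direction. *)
have [j Lj] : exists j, least (fun i =>
    f (y + alpha ^+ i *: d) - f y <=
    delta * (g^T *m (y + alpha ^+ i *: d - y)) 0 0) j.
  apply: least_exists; have [d0|d0] := eqVneq d 0.
    by exists 0%N; rewrite d0 scaler0 addr0 !subrr mulmx0 mxE mulr0.
  have gd : (g^T *m d) 0 0 < 0.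
    have -> : g^T *m d = - (d^T *m B y *m d)^T.
      by rewrite -mulmxA Bd mulmxN [(- _)^T]linearN /= opprK trmx_mul trmxK.
    by rewrite mxE mxE oppr_lt0 Bpd.
  have [i Hi] := armijo_backtracking (f_diff y d) gd.
  by exists i; rewrite [y + _]addrC addrK -scalemxAr mxE addrC.
by exists (y + alpha ^+ j *: d), d, j.
Qed.

(** A step relation that is functional and never stuck has exactly one
    trajectory from each starting point. *)
Lemma line_search_method_exists_unique y0 :
  exists y, forall y', line_search_method delta alpha f B y0 y' <-> y' =1 y.
Proof.
have [next nextP] := choice line_search_step_exists.
exists (fun k => iter k next y0) => y'; split=> [[y'0 y'S] k|y'E].
  elim: k => [//|k IHk]; rewrite iterS -IHk.
  exact: line_search_step_inj (y'S k) (nextP _).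
by split=> [|k]; rewrite !y'E //; exact: nextP.
Qed.

End LineSearch.

(** * Semi-reduced steps as lifted line search steps *)

Section SemiReduced.
Context {R : realType} {p q : nat}.
Variables (delta alpha : R) (F : 'cV[R]_(p + q) -> R).
Variables (zm : 'cV[R]_p -> 'cV[R]_q).
Variables (Bf : 'cV[R]_(p + q) -> 'M[R]_(p + q)).

Let lift y := col_mx y (zm y).
Let f y := F (lift y).
Let B y := schur (Bf (lift y)).

(** An envelope property: the motion of zm y does not contribute to the slope. *)
Hypothesis gradE : forall y, usubmx (gradient F (lift y)) = gradient f y.

Lemma semi_reduced_stepE y x' :
  semi_reduced_step delta alpha F zm Bf (lift y) x' <->
  exists2 y', line_search_step delta alpha f B y y' & x' = lift y'.
Proof.
rewrite /semi_reduced_step gradE col_mxKu.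
split=> [[d [j [E L ->]]]|[_ [d [j [E L ->]]] ->]].
  by exists (y + alpha ^+ j *: d) => //; exists d, j.
by exists d, j.
Qed.

(** Every iterate lies on the graph of zm, the first by the choice of the
    starting point and the others because steps only produce lifted points; so
    the method is determined by its first components. *)
Lemma semi_reduced_methodE y0 x' :
  semi_reduced_method delta alpha F zm Bf y0 x' <->
  exists2 y', line_search_method delta alpha f B y0 y' &
    x' =1 (fun k => lift (y' k)).
Proof.
split=> [[x0 xS]|[y' [y'0 y'S] xE]]; last first.
  split=> [|k]; first by rewrite xE y'0.
  by rewrite !xE; apply/semi_reduced_stepE; exists (y' k.+1).
have xE k : x' k = lift (usubmx (x' k)).
  elim: k => [|k IHk]; first by rewrite x0 col_mxKu.
  have := xS k; rewrite IHk => /semi_reduced_stepE[y' _ ->].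
  by rewrite /lift col_mxKu.
exists (fun k => usubmx (x' k)) => //; split=> [|k]; first by rewrite x0 col_mxKu.
have := xS k; rewrite {1}xE => /semi_reduced_stepE[y' Sy' ->].
by rewrite /lift col_mxKu.
Qed.

End SemiReduced.
(** * Directional derivatives *)

Section Derivatives.
Context {R : realType}.

Lemma is_derive_halfsqnorm (V : normedModType R) n (r : V -> 'cV[R]_n) dr t v :
  is_derive t v r dr ->
  is_derive t v (fun x => 2^-1 * sqnorm (r x)) (((r t)^T *m dr) 0 0).
Proof.
move=> rd; have /is_derive_mxP/(_ 0 0) := is_derive_mulmx (is_derive_trmx rd) rd.
move=> sqd.
have -> : (fun x => 2^-1 * sqnorm (r x)) =
    2^-1 \*: (fun x => ((r x)^T *m r x) 0 0) by [].
apply: is_derive_eq.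
have -> : dr^T *m r t = ((r t)^T *m dr)^T by rewrite trmx_mul trmxK.
rewrite mxE [X in X + _]mxE /GRing.scale /= -mulr2n -[X in _ * X]mulr_natl.
by rewrite mulKf ?pnatr_eq0.
Qed.

Lemma derive_linear_col n (V : normedModType R) (f : 'cV[R]_n -> V) x v :
  differentiable f x -> 'D_v f x = \sum_j v j 0 *: pderive j f x.
Proof.
move=> fd; rewrite deriveE // {1}(_ : v = \sum_j v j 0 *: delta_mx j 0).
  by rewrite linear_sum; apply: eq_bigr => j _; rewrite linearZ /pderive deriveE.
by rewrite {1}[v]matrix_sum_delta; apply: eq_bigr => i _; rewrite big_ord1.
Qed.

Lemma delta_mx_lshift p q (j : 'I_p) :
  delta_mx (lshift q j) 0 = col_mx (delta_mx j 0) 0 :> 'cV[R]_(p + q).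
Proof.
apply/colP => l; rewrite !mxE; case: (split_ordP l) => l' ->;
by rewrite !mxE ?eq_lshift ?eq_rlshift ?eq_lrshift.
Qed.

Lemma delta_mx_rshift p q (j : 'I_q) :
  delta_mx (rshift p j) 0 = col_mx 0 (delta_mx j 0) :> 'cV[R]_(p + q).
Proof.
apply/colP => l; rewrite !mxE; case: (split_ordP l) => l' ->;
by rewrite !mxE ?eq_rshift ?eq_rlshift ?eq_lrshift.
Qed.

End Derivatives.

(** The cross terms vanish because X *m P = 0. *)
Lemma gram_sub_orthogonal (R : realType) m p q (P : 'M[R]_m) (X : 'M[R]_(q, m))
    (J : 'M[R]_(m, p)) (E : 'M[R]_(q, p)) :
  P^T = P -> P *m P = P -> X *m P = 0 ->
  (P *m J - X^T *m E)^T *m (P *m J - X^T *m E) =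
  J^T *m P *m J + E^T *m (X *m X^T) *m E.
Proof.
move=> PT PP XP.
have PX : P *m X^T = 0 by rewrite -PT -trmx_mul XP trmx0.
rewrite [(_ - _)^T]linearB /= !trmx_mul trmxK PT mulmxBl !mulmxBr !mulmxA.
rewrite -(mulmxA _ P P) PP -(mulmxA _ P X^T) PX -(mulmxA _ X P) XP.
by rewrite !(mulmx0, mul0mx) subr0 sub0r opprK.
Qed.

(** * Gradient and model matrix of the reduced objective *)

Section VariableProjection.
Context {R : realType} {m Ny Nz : nat}.
Variables (A : 'cV[R]_Ny -> 'M[R]_(m, Nz)) (b : 'cV[R]_m).
Hypothesis dA : forall y, differentiable A y.
Hypothesis rkA : forall y, \rank (A y) = Nz.

Let dAv y v : is_derive y v A ('D_v A y).
Proof. by apply: DeriveDef => //; exact: diff_derivable. Qed.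

Lemma is_derive_mu x v :
  is_derive x v (mu A)
    ('D_(usubmx v) A (usubmx x) *m dsubmx x + A (usubmx x) *m dsubmx v).
Proof.
apply: is_derive_mulmx.
  by apply: (@is_derive_lin R _ _ _ usubmx); exact: dAv.
by apply: (@is_derive_lin R _ _ _ dsubmx id); exact: is_derive_id.
Qed.

Lemma pderive_muE k (i : 'I_m) :
  pderive k (fun u => mu A u i 0) =
  fun x => ('D_(usubmx (delta_mx k 0)) A (usubmx x) *m dsubmx x +
            A (usubmx x) *m dsubmx (delta_mx k 0)) i 0.
Proof.
apply/funext => x; have /is_derive_mxP/(_ i 0) := is_derive_mu x (delta_mx k 0).
by move=> d; exact: derive_val.
Qed.

(** As mu is linear in z, d_(z_k) mu is column k of A, and one further
    derivative in y_j remains. *)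
Lemma ursubmx_EmxE x : ursubmx (Emx A b x) =
  \matrix_(j, k) ((mu A x - b)^T *m pderive j A (usubmx x)) 0 k.
Proof.
apply/matrixP => j k; rewrite !mxE summxE; apply: eq_bigr => i _.
rewrite !mxE pderive_muE delta_mx_rshift col_mxKu col_mxKd.
congr (_ * _).
have -> : (fun u : 'cV_(Ny + Nz) => ('D_0 A (usubmx u) *m dsubmx u +
    A (usubmx u) *m delta_mx k 0) i 0) = fun u => A (usubmx u) i k.
  by apply/funext => u; rewrite derive0 mul0mx add0r -colE mxE.
have Ad : is_derive x (delta_mx (lshift Nz j) 0) (fun u => A (usubmx u))
    (pderive j A (usubmx x)).
  apply: (@is_derive_lin R _ _ _ usubmx).
  by rewrite delta_mx_lshift /= col_mxKu; exact: dAv.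
by move/is_derive_mxP: Ad => /(_ i k) ?; exact: derive_val.
Qed.

(** In this block d_(y_j) is taken first, and d_(y_j) mu = (d_j A) z is linear
    in z with matrix d_j A. *)
Lemma dlsubmx_EmxE x : dlsubmx (Emx A b x) = (ursubmx (Emx A b x))^T.
Proof.
rewrite ursubmx_EmxE; apply/matrixP => k j; rewrite !mxE summxE.
apply: eq_bigr => i _.
rewrite !mxE pderive_muE delta_mx_lshift col_mxKu col_mxKd.
congr (_ * _).
have Md : is_derive x (delta_mx (rshift Ny k) 0)
    (fun u : 'cV_(Ny + Nz) => pderive j A (usubmx u) *m dsubmx u +
      A (usubmx u) *m 0) (pderive j A (usubmx x) *m delta_mx k 0).
  have -> : (fun u : 'cV_(Ny + Nz) => pderive j A (usubmx u) *m dsubmx u +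
      A (usubmx u) *m 0) = fun u => pderive j A (usubmx u) *m dsubmx u.
    by apply/funext => u; rewrite mulmx0 addr0.
  (* The first factor is constant along the z-direction. *)
  have Ud : is_derive x (delta_mx (rshift Ny k) 0)
      (fun u : 'cV_(Ny + Nz) => pderive j A (usubmx u)) 0.
    apply: (@is_derive_lin R _ _ _ usubmx).
    rewrite delta_mx_rshift /= col_mxKu; apply: DeriveDef; last exact: derive0.
    exact: derivable0.
  have Dd : is_derive x (delta_mx (rshift Ny k) 0)
      (fun u : 'cV_(Ny + Nz) => dsubmx u) (delta_mx k 0).
    apply: (@is_derive_lin R _ _ _ dsubmx id).
    by rewrite delta_mx_rshift /= col_mxKd; exact: is_derive_id.
  by have := is_derive_mulmx Ud Dd; rewrite mul0mx add0r.
move/is_derive_mxP: Md => /(_ i 0); rewrite -colE mxE => ?.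
exact: derive_val.
Qed.

Let r y := resred A b y.
Let X y := lpinv (A y).

(** The normal equations for z_m(y). *)
Lemma trA_resred y : (A y)^T *m r y = 0.
Proof.
rewrite /r /resred mulmxN mulmxA -tr_projperp -trmx_mul projperp_mul //.
by rewrite trmx0 mul0mx oppr0.
Qed.

Lemma lpinv_gram y : X y *m (X y)^T = invmx ((A y)^T *m A y).
Proof.
rewrite /X /lpinv trmx_mul trmxK trmx_inv trmx_mul trmxK -mulmxA.
by rewrite [_^T *m (_ *m _)]mulmxA mulmxV ?gram_unit // mulmx1.
Qed.

Lemma lpinv_projperp y : X y *m projperp (A y) = 0.
Proof.
by rewrite /projperp mulmxBr mulmx1 mulmxA lpinvK // mul1mx subrr.
Qed.

Lemma projperp_idem y : projperp (A y) *m projperp (A y) = projperp (A y).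
Proof.
by rewrite {1}/projperp mulmxBl mul1mx -mulmxA lpinv_projperp mulmx0 subr0.
Qed.

Let Jy y : 'M[R]_(m, Ny) := \matrix_(i, j) (pderive j A y *m zmin A b y) i 0.
Let Ezy y := dlsubmx (Emx A b (ylift A b y)).

(** In the explicit Golub-Pereyra column, (d_j A) A^+ b is (d_j A) z_m, which
    is column j of J_y, and - (d_j A)^T P b = (d_j A)^T r is column j of E_zy. *)
Lemma Kred_split y : Kred A b y = projperp (A y) *m Jy y - (X y)^T *m Ezy y.
Proof.
apply/matrixP => i j; set D := pderive j A y.
have JyE : col j (Jy y) = D *m zmin A b y by apply/colP => k; rewrite !mxE.
have EzyE : col j (Ezy y) = D^T *m r y.
  rewrite /Ezy dlsubmx_EmxE ursubmx_EmxE /ylift residual_zmin col_mxKu -/(r y).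
  rewrite -[RHS]trmxK trmx_mul trmxK -/D.
  by apply/colP => k; rewrite mxE mxE mxE [RHS]mxE.
have -> : (projperp (A y) *m Jy y - (X y)^T *m Ezy y) i j =
    (projperp (A y) *m (D *m zmin A b y) - (X y)^T *m (D^T *m r y)) i 0.
  by rewrite -JyE -EzyE !colE !mulmxA -mulmxBl -colE [RHS]mxE.
rewrite KredE // mxE mxE /= mxE opprK; congr (_ i 0).
rewrite mulmxDl !trmx_mul tr_projperp /r /resred /zmin !mulmxN opprK.
by rewrite !mulmxA.
Qed.

Lemma schur_GmxE y :
  schur (Gmx A (ylift A b y)) = (Jy y)^T *m projperp (A y) *m Jy y.
Proof.
rewrite /schur /Gmx /ylift jacobian_muE // -/(Jy y) tr_row_mx mul_col_row.
rewrite block_mxKul block_mxKur block_mxKdr block_mxKdl.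
by rewrite /projperp /lpinv mulmxBr mulmxBl mulmx1 !mulmxA.
Qed.

(** The second-order term E_yz (A^T A)^{-1} E_zy of H is exactly the Gram
    matrix of the component of K_r in the range of A. *)
Lemma schur_Hmodel y : schur (Hmodel A b (ylift A b y)) = Bred A b y.
Proof.
have GzzE : drsubmx (Gmx A (ylift A b y)) = (A y)^T *m A y.
  by rewrite /Gmx /ylift jacobian_muE // tr_row_mx mul_col_row block_mxKdr.
have EyzE : ursubmx (Emx A b (ylift A b y)) = (Ezy y)^T.
  by rewrite /Ezy dlsubmx_EmxE trmxK.
rewrite /Hmodel schur_udu GzzE ?gram_unit // schur_GmxE EyzE -lpinv_gram.
rewrite /Bred Kred_split gram_sub_orthogonal //.
- exact: tr_projperp.
- exact: projperp_idem.
- exact: lpinv_projperp.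
Qed.

Lemma derivable_zmin y v : derivable (zmin A b) y v.
Proof.
have dAT := is_derive_trmx (dAv y v).
have [Gd _] := is_derive_mulmx dAT (dAv y v).
have Gi : derivable (fun u => invmx ((A u)^T *m A u)) y v.
  by apply: derivable_invmx => // u; exact: gram_unit.
by case: (is_derive_mulmx (is_derive_mulmx (derivableP Gi) dAT)
                          (is_derive_cst b y v)).
Qed.

(** Envelope property: the term r^T A (D_v z_m) coming from the motion of the
    minimizer vanishes by the normal equations. *)
Lemma is_derive_Fred y v :
  is_derive y v (Fred A b) (((r y)^T *m ('D_v A y *m zmin A b y)) 0 0).
Proof.
have rd : is_derive y v (fun u => A u *m zmin A b u - b)
    ('D_v A y *m zmin A b y + A y *m 'D_v (zmin A b) y - 0).
  have Azd := is_derive_mulmx (dAv y v) (derivableP (@derivable_zmin y v)).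
  exact: is_deriveB.
have rE u : A u *m zmin A b u - b = r u.
  by rewrite /r -residual_zmin /mu col_mxKu col_mxKd.
have -> : Fred A b = fun u => 2^-1 * sqnorm (A u *m zmin A b u - b).
  by apply/funext => u; rewrite FredE rE.
apply: is_derive_eq; first exact: is_derive_halfsqnorm rd.
have rA : (r y)^T *m A y = 0.
  by rewrite -[LHS]trmxK trmx_mul trmxK trA_resred trmx0.
by rewrite subr0 rE mulmxDr [X in _ + X]mulmxA rA mul0mx addr0.
Qed.

Lemma derive_Fred y v :
  'D_v (Fred A b) y = ((r y)^T *m ('D_v A y *m zmin A b y)) 0 0.
Proof. by case: (is_derive_Fred y v). Qed.

Lemma usubmx_gradient_Fobj y :
  usubmx (gradient (Fobj A b) (ylift A b y)) = gradient (Fred A b) y.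
Proof.
apply/colP => j; rewrite !mxE /pderive derive_Fred.
have mud : is_derive (ylift A b y) (delta_mx (lshift Nz j) 0)
    (fun x => mu A x - b) ('D_(delta_mx j 0) A y *m zmin A b y - 0).
  apply: is_deriveB; apply: is_derive_eq; first exact: is_derive_mu.
  by rewrite delta_mx_lshift !(col_mxKu, col_mxKd) mulmx0 addr0.
have [_ ->] := is_derive_halfsqnorm mud; rewrite subr0.
by rewrite /ylift residual_zmin.
Qed.

(** Linearity of D_v F_r in v is inherited from that of D_v A, through the
    formula above. *)
Lemma is_derive_Fred_gradient y v :
  is_derive y v (Fred A b) (((gradient (Fred A b) y)^T *m v) 0 0).
Proof.
apply: is_derive_eq; first exact: is_derive_Fred.
rewrite derive_linear_col // mulmx_suml mulmx_sumr summxE [RHS]mxE.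
apply: eq_bigr => j _; rewrite -scalemxAl -scalemxAr [LHS]mxE mulrC.
by congr (_ * _); rewrite [RHS]mxE [RHS]mxE /pderive derive_Fred.
Qed.

End VariableProjection.

(** * Equivalence of the two methods *)

Theorem corollary7 (R : realType) (m Ny Nz : nat)
    (A : 'cV[R]_Ny -> 'M[R]_(m, Nz)) (b : 'cV[R]_m)
    (delta alpha : R) (y0 : 'cV[R]_Ny)
    (delta_bounds : 0 < delta < 1 / 2) (alpha_bounds : 0 < alpha < 1)
    (A_twice_diff : twice_differentiable A)
    (A_full_col_rank : forall y, \rank (A y) = Nz)
    (H_posdef : forall y, posdefmx (Hmodel A b (col_mx y (zmin A b y)))) :
  exists y : nat -> 'cV[R]_Ny,
    (forall y', golub_pereyra_method delta alpha A b y0 y' <-> y' =1 y) /\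
    (forall x', semi_reduced_H_method delta alpha A b y0 x' <->
       x' =1 (fun k => col_mx (y k) (zmin A b (y k)))).
Proof.
have [dA _] := A_twice_diff.
have BE : (fun y => schur (Hmodel A b (ylift A b y))) = Bred A b.
  by apply/funext => y; exact: schur_Hmodel.
have Bpd y : posdefmx (Bred A b y).
  rewrite -BE; have := H_posdef y; rewrite /Hmodel => /posdefmx_congr.
  rewrite schur_udu; last first.
    rewrite /Gmx /ylift jacobian_muE // tr_row_mx mul_col_row block_mxKdr.
    exact: gram_unit.
  rewrite unitmxE det_ublock !det1 mul1r unitr1 => /(_ isT) /posdefmx_ulsub.
  by rewrite block_mxKul.
have [y yP] := line_search_method_exists_unique delta_bounds alpha_bounds Bpd
  (is_derive_Fred_gradient b dA A_full_col_rank) y0.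
exists y; split=> [//|x'].
have gradE := usubmx_gradient_Fobj b dA A_full_col_rank.
apply: (iff_trans (semi_reduced_methodE delta alpha _ gradE y0 x')).
rewrite BE; split=> [[y' /yP y'E x'E] k|x'E]; first by rewrite x'E y'E.
by exists y => //; apply/yP.
Qed.
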